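(* Consider the system of ionized gas dynamics described in the context and a state $(\alpha,T)$ with $0<\alpha<1$, $T>0$. If either $\alpha\le 60\left(\frac{T}{T_{\rm i}}\right)^3$ or $\frac{T_{\rm i}}{T}\le 54.5375$, then each eigenvalue $\lambda_\pm$ is genuinely nonlinear at $(\alpha,T)$, i.e. $R_\pm\nabla\lambda_\pm>0$.
   Context: Fix positive constants $a^2$, $T_{\rm i}$, $\kappa$. Thermodynamic states of the ionized gas are pairs $(\alpha,T)$ with $0<\alpha<1$ (degree of ionization) and $T>0$ (temperature). The pressure is $p=\frac1\kappa\frac{1-\alpha^2}{\alpha^2}T^{5/2}e^{-T_{\rm i}/T}$ (so $(p,T)$ may be used as coordinates, with $\alpha=(1+\kappa pT^{-5/2}e^{T_{\rm i}/T})^{-1/2}$), the specific volume is $v=a^2(1+\alpha)T/p$, the internal energy is $e=a^2\left[\frac32(1+\alpha)T+T_{\rm i}\alpha\right]$, and the dimensionless entropy (with $a^2T\,d\eta=de+p\,dv$) is, up to a constant, $\eta=-2\log\frac{1-\alpha}{\alpha}+(1+\alpha)\left(\frac52+\frac{T_{\rm i}}{T}\right)$. The system in Lagrangian coordinates, $v_t-u_\xi=0$, $u_t+p_\xi=0$, $(e+\frac12u^2)_t+(pu)_\xi=0$, has eigenvalues $\lambda_\pm=\pm\lambda$ and $0$, with $\lambda>0$ and $$\lambda^2=\frac{p^2\left[\frac52+\frac12\alpha(1-\alpha)\left(\frac52+\frac{T_{\rm i}}{T}\right)^2\right]}{a^2T(1+\alpha)\left[\frac32+\frac12\alpha(1-\alpha)\left(\frac{15}{4}+\frac{3T_{\rm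 i}}{T}+\frac{T_{\rm i}^2}{T^2}\right)\right]}.$$ In the variables $(p,T)$, $R_\pm\nabla=\pm\left(\frac{\partial}{\partial p}-\frac{\eta_p}{\eta_T}\frac{\partial}{\partial T}\right)$ is the derivative along the $\pm$ characteristic field, and $R_+\nabla\lambda_+=R_-\nabla\lambda_-$. Genuine nonlinearity of $\lambda_\pm$ at a state means $R_\pm\nabla\lambda_\pm>0$ there. *)

(* Defs.v *)
From Stdlib Require Import Reals Lra Psatz.
From Coquelicot Require Import Coquelicot.
Open Scope R_scope.

(** Throughout, [a2] stands for the constant a^2.  Thermodynamic quantities are
    functions of the coordinates [(p, T)], [p > 0], [T > 0]. *)

Definition pressure (Ti kappa alpha T : R) : R :=
  / kappa * ((1 - alpha ^ 2) / alpha ^ 2) * Rpower T (5 / 2) * exp (- (Ti / T)).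

Definition ionization (Ti kappa p T : R) : R :=
  Rpower (1 + kappa * p * Rpower T (- (5 / 2)) * exp (Ti / T)) (- (1 / 2)).

Definition volume (a2 Ti kappa p T : R) : R :=
  a2 * (1 + ionization Ti kappa p T) * T / p.

Definition energy (a2 Ti kappa p T : R) : R :=
  let alpha := ionization Ti kappa p T in
  a2 * (3 / 2 * (1 + alpha) * T + Ti * alpha).

Definition entropy (Ti kappa p T : R) : R :=
  let alpha := ionization Ti kappa p T in
  - 2 * ln ((1 - alpha) / alpha) + (1 + alpha) * (5 / 2 + Ti / T).

Definition lambda_sq (a2 Ti kappa p T : R) : R :=
  let alpha := ionization Ti kappa p T in
  (p ^ 2 * (5 / 2 + 1 / 2 * alpha * (1 - alpha) * (5 / 2 + Ti / T) ^ 2))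
  / (a2 * T * (1 + alpha) *
     (3 / 2 + 1 / 2 * alpha * (1 - alpha)
              * (15 / 4 + 3 * Ti / T + Ti ^ 2 / T ^ 2))).

Definition lambda_plus (a2 Ti kappa p T : R) : R :=
  sqrt (lambda_sq a2 Ti kappa p T).

Definition lambda_minus (a2 Ti kappa p T : R) : R :=
  - sqrt (lambda_sq a2 Ti kappa p T).

Definition d_p (f : R -> R -> R) (p T : R) : R := Derive (fun q => f q T) p.
Definition d_T (f : R -> R -> R) (p T : R) : R := Derive (fun S => f p S) T.

(** [R_plus Ti kappa f p T] is the derivative of [f] along the field R_+ at
    [(p, T)]; similarly for [R_minus]. *)
Definition R_plus (Ti kappa : R) (f : R -> R -> R) (p T : R) : R :=
  let eta := entropy Ti kappa in
  d_p f p T - d_p eta p T / d_T eta p T * d_T f p T.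

Definition R_minus (Ti kappa : R) (f : R -> R -> R) (p T : R) : R :=
  let eta := entropy Ti kappa in
  - (d_p f p T - d_p eta p T / d_T eta p T * d_T f p T).

Definition genuinely_nonlinear_plus (a2 Ti kappa p T : R) : Prop :=
  0 < R_plus Ti kappa (lambda_plus a2 Ti kappa) p T.

Definition genuinely_nonlinear_minus (a2 Ti kappa p T : R) : Prop :=
  0 < R_minus Ti kappa (lambda_minus a2 Ti kappa) p T.

(** The eigenvalues of the Lagrangian system

      v_t - u_xi = 0,   u_t + p_xi = 0,   (e + u^2/2)_t + (p u)_xi = 0

    at the state [(p, u, T)]: the numbers [c] such that DF r = c DW r for some
    nonzero r, where W = (v, u, e + u^2/2) and F = (-u, p, p u) as functions of
    [(p, u, T)].  [eigenvalues_system] below identifies them with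
    [lambda_minus], 0 and [lambda_plus]. *)
Definition differential3 (f : R -> R -> R -> R) (p u T rp ru rT : R) : R :=
  Derive (fun q => f q u T) p * rp + Derive (fun w => f p w T) u * ru
  + Derive (fun S => f p u S) T * rT.

Definition system_eigenvalue (a2 Ti kappa p u T c : R) : Prop :=
  exists rp ru rT : R,
    ~ (rp = 0 /\ ru = 0 /\ rT = 0) /\
    differential3 (fun _ w _ => - w) p u T rp ru rT
    = c * differential3 (fun q _ S => volume a2 Ti kappa q S) p u T rp ru rT /\
    differential3 (fun q _ _ => q) p u T rp ru rT
    = c * differential3 (fun _ w _ => w) p u T rp ru rT /\
    differential3 (fun q w _ => q * w) p u T rp ru rT
    = c * differential3 (fun q w S => energy a2 Ti kappa q S + 1 / 2 * w ^ 2)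
            p u T rp ru rT.

Lemma ionization_bounds (Ti kappa p T : R) :
  0 < kappa -> 0 < p -> 0 < ionization Ti kappa p T < 1.
Proof.
intros Hk Hp; unfold ionization.
assert (HX : 0 < kappa * p * Rpower T (- (5 / 2)) * exp (Ti / T)).
{ repeat apply Rmult_lt_0_compat; try assumption; apply exp_pos. }
split; [apply exp_pos|].
set (Y := 1 + _) in *.
assert (0 < ln Y) by (rewrite <- ln_1; apply ln_increasing; unfold Y; lra).
apply Rlt_le_trans with (exp 0); [apply exp_increasing|rewrite exp_0]; lra.
Qed.

Lemma ionization_sq (Ti kappa p T : R) :
  0 < kappa -> 0 < p ->
  ionization Ti kappa p T ^ 2
  * (1 + kappa * p * Rpower T (- (5 / 2)) * exp (Ti / T)) = 1.
Proof.
intros Hk Hp; unfold ionization.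
assert (HX : 0 < kappa * p * Rpower T (- (5 / 2)) * exp (Ti / T)).
{ repeat apply Rmult_lt_0_compat; try assumption; apply exp_pos. }
set (Y := 1 + _) in *.
assert (HY : 0 < Y) by (unfold Y; lra).
rewrite <- Rpower_pow by apply exp_pos.
rewrite Rpower_mult.
replace (- (1 / 2) * INR 2) with (Ropp 1) by (simpl; lra).
rewrite Rpower_Ropp, Rpower_1 by assumption.
field; lra.
Qed.

Lemma ionization_pressure (Ti kappa alpha T : R) :
  0 < kappa -> 0 < alpha < 1 -> 0 < T ->
  ionization Ti kappa (pressure Ti kappa alpha T) T = alpha.
Proof.
intros Hk Ha HT.
assert (Hp : 0 < pressure Ti kappa alpha T).
{ unfold pressure; repeat apply Rmult_lt_0_compat; try apply exp_pos.
  - now apply Rinv_0_lt_compat.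
  - unfold Rminus; nra.
  - apply Rinv_0_lt_compat; nra. }
assert (Hs := ionization_sq Ti kappa _ T Hk Hp).
assert (Hb := ionization_bounds Ti kappa _ T Hk Hp).
assert (HX : 1 + kappa * pressure Ti kappa alpha T
             * Rpower T (- (5 / 2)) * exp (Ti / T) = / alpha ^ 2).
{ unfold pressure; rewrite Rpower_Ropp, exp_Ropp.
  assert (0 < Rpower T (5 / 2)) by apply exp_pos.
  assert (0 < exp (Ti / T)) by apply exp_pos.
  field; repeat split; lra. }
rewrite HX in Hs.
assert (ionization Ti kappa (pressure Ti kappa alpha T) T ^ 2 = alpha ^ 2).
{ apply (Rmult_eq_reg_r (/ alpha ^ 2)).
  - rewrite Hs; field; lra.
  - apply Rinv_neq_0_compat; nra. }
nra.
Qed.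

Lemma is_derive_ionization_p (Ti kappa p T : R) :
  0 < kappa -> 0 < p -> 0 < T ->
  let alpha := ionization Ti kappa p T in
  is_derive (fun q => ionization Ti kappa q T) p
    (- (alpha * (1 - alpha ^ 2) / (2 * p))).
Proof.
intros Hk Hp HT alpha.
assert (Hs := ionization_sq Ti kappa p T Hk Hp); fold alpha in Hs.
assert (HX : 0 < kappa * p * Rpower T (- (5 / 2)) * exp (Ti / T)).
{ repeat apply Rmult_lt_0_compat; try assumption; apply exp_pos. }
unfold ionization in *; set (K := Rpower T (- (5 / 2))) in *.
set (E := exp (Ti / T)) in *.
unfold Rpower in alpha |- *.
auto_derive; [lra|].
set (Y := 1 + kappa * p * K * E) in *.
change (exp (- (1 / 2) * ln Y)) with alpha.
assert (HY : kappa * K * E = (Y - 1) / p) by (unfold Y; field; lra).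
assert (0 < Y) by (unfold Y; lra).
assert (Ha : alpha ^ 2 = / Y).
{ apply (Rmult_eq_reg_r Y); [rewrite Hs; field|]; lra. }
rewrite Ha, Rmult_1_r, HY.
clearbody Y alpha; field; lra.
Qed.

Lemma is_derive_ionization_T (Ti kappa p T : R) :
  0 < kappa -> 0 < p -> 0 < T ->
  let alpha := ionization Ti kappa p T in
  is_derive (fun S => ionization Ti kappa p S) T
    (alpha * (1 - alpha ^ 2) * (5 / 2 + Ti / T) / (2 * T)).
Proof.
intros Hk Hp HT alpha.
assert (Hs := ionization_sq Ti kappa p T Hk Hp); fold alpha in Hs.
assert (HX : 0 < kappa * p * Rpower T (- (5 / 2)) * exp (Ti / T)).
{ repeat apply Rmult_lt_0_compat; try assumption; apply exp_pos. }
unfold ionization, Rpower in *.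
auto_derive; [repeat split; lra|].
change (Ti * / T) with (Ti / T).
set (K := exp (- (5 / 2) * ln T)) in *; set (E := exp (Ti / T)) in *.
set (Y := 1 + kappa * p * K * E) in *.
change (exp (- (1 / 2) * ln Y)) with alpha.
assert (0 < Y) by (unfold Y; lra).
assert (0 < E) by apply exp_pos.
assert (HK : K = (Y - 1) / (kappa * p * E))
  by (unfold Y; field; repeat split; lra).
assert (Ha : alpha ^ 2 = / Y).
{ apply (Rmult_eq_reg_r Y); [rewrite Hs; field|]; lra. }
rewrite Ha, HK.
clearbody Y alpha E; field; repeat split; lra.
Qed.

Section Derivatives.

Context (a2 Ti kappa p T : R).
Context (Ha2 : 0 < a2) (HTi : 0 < Ti) (Hk : 0 < kappa) (Hp : 0 < p) (HT : 0 < T).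

Let alpha := ionization Ti kappa p T.
Let alpha_p := - (alpha * (1 - alpha ^ 2) / (2 * p)).
Let alpha_T := alpha * (1 - alpha ^ 2) * (5 / 2 + Ti / T) / (2 * T).

Local Lemma dalpha_p : is_derive (fun q => ionization Ti kappa q T) p alpha_p.
Proof. now apply is_derive_ionization_p. Qed.

Local Lemma dalpha_T : is_derive (fun S => ionization Ti kappa p S) T alpha_T.
Proof. now apply is_derive_ionization_T. Qed.

Local Lemma Dalpha_p :
  Derive (fun q : R => ionization Ti kappa q T) p = alpha_p.
Proof. exact (is_derive_unique _ _ _ dalpha_p). Qed.

Local Lemma Dalpha_T :
  Derive (fun S : R => ionization Ti kappa p S) T = alpha_T.
Proof. exact (is_derive_unique _ _ _ dalpha_T). Qed.

Local Ltac by_chain H D :=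
  auto_derive;
  [repeat split; try (eexists; exact H); try lra
  |rewrite D; fold alpha].

Lemma is_derive_volume_p :
  is_derive (fun q => volume a2 Ti kappa q T) p
    (a2 * T * (alpha_p / p - (1 + alpha) / p ^ 2)).
Proof.
unfold volume; by_chain dalpha_p Dalpha_p.
field; lra.
Qed.

Lemma is_derive_volume_T :
  is_derive (fun S => volume a2 Ti kappa p S) T
    (a2 / p * (alpha_T * T + (1 + alpha))).
Proof.
unfold volume; by_chain dalpha_T Dalpha_T.
field; lra.
Qed.

Lemma is_derive_energy_p :
  is_derive (fun q => energy a2 Ti kappa q T) p
    (a2 * (3 / 2 * T + Ti) * alpha_p).
Proof.
unfold energy; by_chain dalpha_p Dalpha_p.
field; lra.
Qed.

Lemma is_derive_energy_T :
  is_derive (fun S => energy a2 Ti kappa p S) T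
    (a2 * (3 / 2 * (1 + alpha) + (3 / 2 * T + Ti) * alpha_T)).
Proof.
unfold energy; by_chain dalpha_T Dalpha_T.
field; lra.
Qed.

Lemma is_derive_entropy_p :
  is_derive (fun q => entropy Ti kappa q T) p
    ((2 / (alpha * (1 - alpha)) + 5 / 2 + Ti / T) * alpha_p).
Proof.
assert (Hb := ionization_bounds Ti kappa p T Hk Hp); fold alpha in Hb.
unfold entropy; by_chain dalpha_p Dalpha_p.
- fold alpha; lra.
- fold alpha; unfold Rminus; apply Rmult_lt_0_compat;
    [lra|apply Rinv_0_lt_compat; lra].
- field; lra.
Qed.

Lemma is_derive_entropy_T :
  is_derive (fun S => entropy Ti kappa p S) T
    ((2 / (alpha * (1 - alpha)) + 5 / 2 + Ti / T) * alpha_T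
     - (1 + alpha) * Ti / T ^ 2).
Proof.
assert (Hb := ionization_bounds Ti kappa p T Hk Hp); fold alpha in Hb.
unfold entropy; by_chain dalpha_T Dalpha_T.
- fold alpha; lra.
- fold alpha; unfold Rminus; apply Rmult_lt_0_compat;
    [lra|apply Rinv_0_lt_compat; lra].
- field; lra.
Qed.

(** a^2 T d eta = de + p dv *)
Lemma gibbs_p :
  a2 * T * d_p (entropy Ti kappa) p T
  = d_p (energy a2 Ti kappa) p T + p * d_p (volume a2 Ti kappa) p T.
Proof.
assert (Hb := ionization_bounds Ti kappa p T Hk Hp); fold alpha in Hb.
unfold d_p.
rewrite (is_derive_unique _ _ _ is_derive_entropy_p : Derive (fun q : R => _) _ = _).
rewrite (is_derive_unique _ _ _ is_derive_energy_p : Derive (fun q : R => _) _ = _).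
rewrite (is_derive_unique _ _ _ is_derive_volume_p : Derive (fun q : R => _) _ = _).
unfold alpha_p; clearbody alpha; field; lra.
Qed.

Lemma gibbs_T :
  a2 * T * d_T (entropy Ti kappa) p T
  = d_T (energy a2 Ti kappa) p T + p * d_T (volume a2 Ti kappa) p T.
Proof.
assert (Hb := ionization_bounds Ti kappa p T Hk Hp); fold alpha in Hb.
unfold d_T.
rewrite (is_derive_unique _ _ _ is_derive_entropy_T : Derive (fun q : R => _) _ = _).
rewrite (is_derive_unique _ _ _ is_derive_energy_T : Derive (fun q : R => _) _ = _).
rewrite (is_derive_unique _ _ _ is_derive_volume_T : Derive (fun q : R => _) _ = _).
unfold alpha_T; clearbody alpha; field; lra.
Qed.

Lemma entropy_T_gt0 : 0 < d_T (entropy Ti kappa) p T.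
Proof.
assert (Hb := ionization_bounds Ti kappa p T Hk Hp); fold alpha in Hb.
unfold d_T.
rewrite (is_derive_unique _ _ _ is_derive_entropy_T : Derive (fun q : R => _) _ = _).
unfold alpha_T; clearbody alpha.
replace ((2 / (alpha * (1 - alpha)) + 5 / 2 + Ti / T)
         * (alpha * (1 - alpha ^ 2) * (5 / 2 + Ti / T) / (2 * T))
         - (1 + alpha) * Ti / T ^ 2)
  with ((1 + alpha) / T
        * (5 / 2 + alpha * (1 - alpha) * (5 / 2 + Ti / T) ^ 2 / 2))
  by (field; lra).
assert (0 < Ti / T) by now apply Rdiv_lt_0_compat.
apply Rmult_lt_0_compat; [apply Rdiv_lt_0_compat; lra|].
assert (0 < alpha * (1 - alpha)) by (apply Rmult_lt_0_compat; lra).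
assert (0 < (5 / 2 + Ti / T) ^ 2) by (apply pow_lt; lra).
assert (0 < alpha * (1 - alpha) * (5 / 2 + Ti / T) ^ 2)
  by now apply Rmult_lt_0_compat.
lra.
Qed.

Lemma lambda_sq_gt0 : 0 < lambda_sq a2 Ti kappa p T.
Proof.
assert (Hb := ionization_bounds Ti kappa p T Hk Hp); fold alpha in Hb.
unfold lambda_sq; fold alpha; clearbody alpha.
assert (0 < Ti / T) by now apply Rdiv_lt_0_compat.
assert (0 < 3 * Ti / T) by (apply Rdiv_lt_0_compat; lra).
assert (0 < Ti ^ 2 / T ^ 2) by (apply Rdiv_lt_0_compat; apply pow_lt; lra).
assert (0 < alpha * (1 - alpha)) by (apply Rmult_lt_0_compat; lra).
assert (0 < (5 / 2 + Ti / T) ^ 2) by (apply pow_lt; lra).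
apply Rdiv_lt_0_compat; repeat apply Rmult_lt_0_compat; try lra.
- rewrite (Rmult_assoc (1 / 2)).
  assert (0 < 1 / 2 * (alpha * (1 - alpha)) * (5 / 2 + Ti / T) ^ 2)
    by (repeat apply Rmult_lt_0_compat; lra).
  lra.
- rewrite (Rmult_assoc (1 / 2)).
  assert (0 < 1 / 2 * (alpha * (1 - alpha))
              * (15 / 4 + 3 * Ti / T + Ti ^ 2 / T ^ 2))
    by (repeat apply Rmult_lt_0_compat; lra).
  lra.
Qed.

Lemma sound_speed :
  lambda_sq a2 Ti kappa p T
  * (d_T (volume a2 Ti kappa) p T * d_p (entropy Ti kappa) p T
     - d_p (volume a2 Ti kappa) p T * d_T (entropy Ti kappa) p T)
  = d_T (entropy Ti kappa) p T.
Proof.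
assert (Hb := ionization_bounds Ti kappa p T Hk Hp); fold alpha in Hb.
unfold d_T, d_p.
rewrite (is_derive_unique _ _ _ is_derive_entropy_T : Derive (fun q : R => _) _ = _).
rewrite (is_derive_unique _ _ _ is_derive_volume_T : Derive (fun q : R => _) _ = _).
rewrite (is_derive_unique _ _ _ is_derive_entropy_p : Derive (fun q : R => _) _ = _).
rewrite (is_derive_unique _ _ _ is_derive_volume_p : Derive (fun q : R => _) _ = _).
unfold alpha_T, alpha_p, lambda_sq; fold alpha; clearbody alpha.
assert (0 < Ti / T) by now apply Rdiv_lt_0_compat.
assert (0 < alpha * (1 - alpha)) by (apply Rmult_lt_0_compat; lra).
assert (HTz : Ti = Ti / T * T) by (field; lra).
set (z := Ti / T) in *; clearbody z; subst Ti.
field; repeat split; try lra.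
assert (0 < 15 + 3 * z * 4 + z ^ 2 * 4) by nra.
assert (0 < alpha * (1 - alpha) * (15 + 3 * z * 4 + z ^ 2 * 4))
  by now apply Rmult_lt_0_compat.
lra.
Qed.

Local Lemma system_eigenvalueE (u c : R) :
  system_eigenvalue a2 Ti kappa p u T c <->
  exists rp ru rT : R,
    ~ (rp = 0 /\ ru = 0 /\ rT = 0) /\
    - ru = c * (d_p (volume a2 Ti kappa) p T * rp
                + d_T (volume a2 Ti kappa) p T * rT) /\
    rp = c * ru /\
    u * rp + p * ru = c * (d_p (energy a2 Ti kappa) p T * rp + u * ru
                           + d_T (energy a2 Ti kappa) p T * rT).
Proof.
assert (E1 : Derive (fun w : R => - w) u = - 1).
{ apply is_derive_unique; auto_derive; lra. }
assert (E2 : Derive (fun q : R => q * u) p = u).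
{ apply is_derive_unique; auto_derive; lra. }
assert (E3 : Derive (fun w : R => p * w) u = p).
{ apply is_derive_unique; auto_derive; lra. }
assert (E4 : Derive (fun q : R => energy a2 Ti kappa q T + 1 / 2 * u ^ 2) p
             = d_p (energy a2 Ti kappa) p T).
{ rewrite Derive_plus, Derive_const; [apply Rplus_0_r| |apply ex_derive_const].
  eexists; exact is_derive_energy_p. }
assert (E5 : Derive (fun w : R => energy a2 Ti kappa p T + 1 / 2 * w ^ 2) u = u).
{ apply is_derive_unique; auto_derive; lra. }
assert (E6 : Derive (fun S : R => energy a2 Ti kappa p S + 1 / 2 * u ^ 2) T
             = d_T (energy a2 Ti kappa) p T).
{ rewrite Derive_plus, Derive_const; [apply Rplus_0_r| |apply ex_derive_const].
  eexists; exact is_derive_energy_T. }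
unfold system_eigenvalue, differential3.
split; intros (rp & ru & rT & H0 & H1 & H2 & H3); exists rp, ru, rT;
  revert H1 H2 H3; rewrite ?E1, ?E2, ?E3, ?E4, ?E5, ?E6, ?Derive_const, ?Derive_id;
  unfold d_p, d_T; intros H1 H2 H3; repeat split; lra || assumption.
Qed.

Lemma eigenvalues_system (u c : R) :
  system_eigenvalue a2 Ti kappa p u T c <->
  c = lambda_minus a2 Ti kappa p T \/ c = 0 \/ c = lambda_plus a2 Ti kappa p T.
Proof.
assert (Gp := gibbs_p). assert (GT := gibbs_T).
assert (HeT := entropy_T_gt0). assert (HL := lambda_sq_gt0).
assert (HS := sound_speed).
assert (Hs2 := sqrt_sqrt _ (Rlt_le _ _ HL)).
rewrite system_eigenvalueE; unfold lambda_minus, lambda_plus.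
set (vp := d_p (volume a2 Ti kappa) p T) in *.
set (vT := d_T (volume a2 Ti kappa) p T) in *.
set (ep := d_p (energy a2 Ti kappa) p T) in *.
set (eT := d_T (energy a2 Ti kappa) p T) in *.
set (hp := d_p (entropy Ti kappa) p T) in *.
set (hT := d_T (entropy Ti kappa) p T) in *.
set (L := lambda_sq a2 Ti kappa p T) in *.
clearbody vp vT ep eT hp hT L.
assert (HaT : 0 < a2 * T) by now apply Rmult_lt_0_compat.
assert (Hl : 0 < sqrt L) by now apply sqrt_lt_R0.
set (l := sqrt L) in *; clearbody l.
split.
- intros (rp & ru & rT & H0 & H1 & H2 & H3).
  destruct (Req_dec c 0) as [->|Hc]; [now right; left|].
  assert (Hr : hp * rp + hT * rT = 0).
  { apply (Rmult_eq_reg_l (c * (a2 * T))); [|apply Rmult_integral_contrapositive; lra].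
    replace (c * (a2 * T) * (hp * rp + hT * rT))
      with (c * (a2 * T * hp) * rp + c * (a2 * T * hT) * rT) by ring.
    rewrite Gp, GT.
    assert (p * ru = c * (ep * rp + eT * rT)) by (rewrite H2 in H3 at 1; lra).
    assert (p * - ru = p * (c * (vp * rp + vT * rT))) by now rewrite H1.
    lra. }
  assert (HrT : rT = - (hp * rp) / hT) by (field_simplify_eq; lra).
  assert (Hrp : rp <> 0).
  { intros E; apply H0.
    rewrite E in H2, HrT.
    repeat split; trivial.
    - apply (Rmult_eq_reg_l c); lra.
    - rewrite HrT; field; lra. }
  assert (Hc2 : c * c = l * l).
  { rewrite Hs2.
    assert (HD : vT * hp - vp * hT <> 0) by (intros E; rewrite E in HS; lra).
    apply (Rmult_eq_reg_r ((vT * hp - vp * hT) * rp));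
      [|now apply Rmult_integral_contrapositive].
    rewrite <- (Rmult_assoc L), HS.
    assert (E1 : rp = - (c * c) * (vp * rp + vT * rT)).
    { rewrite H2 at 1. replace ru with (- - ru) by ring. rewrite H1. ring. }
    rewrite E1 at 2. rewrite HrT. field; lra. }
  assert (E : (c - l) * (c + l) = 0) by lra.
  apply Rmult_integral in E; destruct E; [right; right|left]; lra.
- assert (Hk2 : forall c, c <> 0 -> c * c = L ->
    exists rp ru rT : R,
    ~ (rp = 0 /\ ru = 0 /\ rT = 0) /\
    - ru = c * (vp * rp + vT * rT) /\ rp = c * ru /\
    u * rp + p * ru = c * (ep * rp + u * ru + eT * rT)).
  { clear c; intros c Hc Hc2; exists 1, (/ c), (- (hp / hT)).
    assert (Hv : c * (vp * 1 + vT * - (hp / hT)) = - / c).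
    { apply (Rmult_eq_reg_r (c * hT)); [|apply Rmult_integral_contrapositive; lra].
      replace (- / c * (c * hT)) with (- hT) by (field; lra).
      transitivity (- (L * (vT * hp - vp * hT))); [|now rewrite HS].
      rewrite <- Hc2; field; lra. }
    split; [lra|]; split; [now rewrite Hv|]; split; [field; lra|].
    replace ep with (a2 * T * hp - p * vp) by lra.
    replace eT with (a2 * T * hT - p * vT) by lra.
    replace (c * ((a2 * T * hp - p * vp) * 1 + u * / c
                  + (a2 * T * hT - p * vT) * - (hp / hT)))
      with (u - p * (c * (vp * 1 + vT * - (hp / hT)))) by (field; lra).
    rewrite Hv; ring. }
  intros [->|[->| ->]].
  + apply Hk2; lra.
  + exists 0, 0, 1; repeat split; lra.
  + apply Hk2; lra.
Qed.

End Derivatives.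

(* Main.v *)
Require Import Defs.
From Stdlib Require Import Reals Lra Psatz.
From Coquelicot Require Import Coquelicot.
Open Scope R_scope.

(** With z = Ti / T and w = alpha (1 - alpha), the logarithmic derivative of
    lambda^2 along R_+ is a positive multiple of an explicit polynomial in
    alpha and z, so genuine nonlinearity is the positivity of that polynomial
    ([R_plus_lambda_sq]).  The logarithmic derivatives of numerator and
    denominator of lambda^2 with respect to w nearly cancel, because

      3 (5/2 + z)^2 - 5 (15/4 + 3 z + z^2) = - 2 z^2,

    and what is left is a sum of positive terms and a single term that can be
    negative, - 2 w z^3 (1 + alpha) (1 - 2 alpha).

    The product of the three factors in the positive part is at least
    (5 + x) (3 + x) (8 + 2 x) with x = w z^2.  Its constant term 120 beats the
    bad term, which is at least - 2 alpha z^3, as soon as alpha z^3 <= 60; this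
    is the first sufficient condition.  Since the bad term is also at least
    - 2 z x, the bound z <= 54.5375 replaces it by a linear function of x
    which the cubic above dominates; this is the second one. *)

(** * The polynomial governing genuine nonlinearity *)

(** The first two factors are twice the numerator and twice the denominator
    bracket of lambda^2. *)
Definition nonlinearity_poly (alpha z : R) : R :=
  let w := alpha * (1 - alpha) in
  (5 + w * (5 / 2 + z) ^ 2) * (3 + w * (15 / 4 + 3 * z + z ^ 2))
    * (8 + w * (10 + 8 * z + 2 * z ^ 2))
  + 2 * z ^ 2 * w * (2 + w * (5 / 2 + z)) ^ 2
  - 2 * z ^ 3 * w * (1 + alpha) * (1 - 2 * alpha).

(** All the terms dropped here are nonnegative; in the bad term,
    (1 + alpha) (1 - 2 alpha) is at most 1. *)
Lemma nonlinearity_poly_gt (alpha z : R) :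
  0 < alpha < 1 -> 0 < z ->
  let x := alpha * (1 - alpha) * z ^ 2 in
  (5 + x) * (3 + x) * (8 + 2 * x) - 2 * z * x < nonlinearity_poly alpha z.
Proof.
intros Ha Hz x; unfold nonlinearity_poly, x; clear x.
assert (Hw : 0 < alpha * (1 - alpha)) by (apply Rmult_lt_0_compat; lra).
assert (Hbad : (1 + alpha) * (1 - 2 * alpha) <= 1) by nra.
set (w := alpha * (1 - alpha)) in *; clearbody w.
assert (Hwz : 0 < w * z) by now apply Rmult_lt_0_compat.
assert (Hx : 0 < w * z ^ 2) by (apply Rmult_lt_0_compat; [|apply pow_lt]; lra).
assert (H1 : 5 + w * z ^ 2 <= 5 + w * (5 / 2 + z) ^ 2) by nra.
assert (H2 : 3 + w * z ^ 2 <= 3 + w * (15 / 4 + 3 * z + z ^ 2)) by nra.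
assert (H3 : 8 + 2 * (w * z ^ 2) <= 8 + w * (10 + 8 * z + 2 * z ^ 2)) by nra.
assert (H123 : (5 + w * z ^ 2) * (3 + w * z ^ 2) * (8 + 2 * (w * z ^ 2))
  <= (5 + w * (5 / 2 + z) ^ 2) * (3 + w * (15 / 4 + 3 * z + z ^ 2))
     * (8 + w * (10 + 8 * z + 2 * z ^ 2))).
{ repeat apply Rmult_le_compat; try lra.
  apply Rlt_le, Rmult_lt_0_compat; lra. }
assert (H4 : 0 < 2 * z ^ 2 * w * (2 + w * (5 / 2 + z)) ^ 2).
{ replace (2 * z ^ 2 * w) with (2 * (w * z ^ 2)) by ring.
  apply Rmult_lt_0_compat; [|apply pow_lt]; nra. }
assert (H5 : 2 * z * (w * z ^ 2) * ((1 + alpha) * (1 - 2 * alpha))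
             <= 2 * z * (w * z ^ 2) * 1).
{ apply Rmult_le_compat_l; [|exact Hbad].
  apply Rlt_le, Rmult_lt_0_compat; lra. }
lra.
Qed.

Lemma nonlinearity_poly_gt0_small_ionization (alpha z : R) :
  0 < alpha < 1 -> 0 < z -> alpha * z ^ 3 <= 60 ->
  0 < nonlinearity_poly alpha z.
Proof.
intros Ha Hz Haz.
assert (Hgt := nonlinearity_poly_gt alpha z Ha Hz); cbv zeta in Hgt.
assert (Hz3 : 0 < alpha * z ^ 3) by (apply Rmult_lt_0_compat; [|apply pow_lt]; lra).
assert (Hbad : z * (alpha * (1 - alpha) * z ^ 2) <= 60) by nra.
assert (Hx : 0 < alpha * (1 - alpha) * z ^ 2).
{ apply Rmult_lt_0_compat; [apply Rmult_lt_0_compat|apply pow_lt]; lra. }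
set (x := alpha * (1 - alpha) * z ^ 2) in *; clearbody x.
nra.
Qed.

Lemma nonlinearity_poly_gt0_high_temperature (alpha z : R) :
  0 < alpha < 1 -> 0 < z <= 545375 / 10000 ->
  0 < nonlinearity_poly alpha z.
Proof.
intros Ha Hz.
assert (Hgt := nonlinearity_poly_gt alpha z Ha (proj1 Hz)); cbv zeta in Hgt.
assert (Hx : 0 < alpha * (1 - alpha) * z ^ 2).
{ apply Rmult_lt_0_compat; [apply Rmult_lt_0_compat|apply pow_lt]; lra. }
set (x := alpha * (1 - alpha) * z ^ 2) in *; clearbody x.
assert (Hbad : z * x <= 545375 / 10000 * x) by (apply Rmult_le_compat_r; lra).
assert (Hx3 : 0 < x ^ 3) by now apply pow_lt.
(* The linear terms 94 x - 109.075 x leave - 15.075 x, absorbed by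
   120 + 24 x^2 through 2 x <= 1 + x^2. *)
assert (Hsq : 0 <= (x - 1) ^ 2) by apply pow2_ge_0.
lra.
Qed.

(** * The derivative of lambda^2 along the characteristic field *)

Definition numerator (alpha z : R) : R :=
  5 / 2 + 1 / 2 * alpha * (1 - alpha) * (5 / 2 + z) ^ 2.

Definition denominator (alpha z : R) : R :=
  3 / 2 + 1 / 2 * alpha * (1 - alpha) * (15 / 4 + 3 * z + z ^ 2).

Lemma numerator_gt0 (alpha z : R) :
  0 < alpha < 1 -> 0 < z -> 0 < numerator alpha z.
Proof.
intros Ha Hz; unfold numerator.
assert (0 < alpha * (1 - alpha)) by (apply Rmult_lt_0_compat; lra).
assert (0 < (5 / 2 + z) ^ 2) by (apply pow_lt; lra).
nra.
Qed.

Lemma denominator_gt0 (alpha z : R) :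
  0 < alpha < 1 -> 0 < z -> 0 < denominator alpha z.
Proof.
intros Ha Hz; unfold denominator.
assert (0 < alpha * (1 - alpha)) by (apply Rmult_lt_0_compat; lra).
assert (0 < 15 / 4 + 3 * z + z ^ 2) by nra.
nra.
Qed.

Lemma lambda_sqE (a2 Ti kappa p T : R) :
  0 < T ->
  let alpha := ionization Ti kappa p T in
  lambda_sq a2 Ti kappa p T
  = p ^ 2 * numerator alpha (Ti / T)
    / (a2 * T * (1 + alpha) * denominator alpha (Ti / T)).
Proof.
intros HT alpha; unfold lambda_sq, numerator, denominator; fold alpha.
do 6 f_equal; field; lra.
Qed.

(** Logarithmic differentiation keeps lambda^2 itself as an opaque factor, so
    that it divides out of the characteristic derivative. *)
Lemma is_derive_lambda_sq_p (a2 Ti kappa p T : R) :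
  0 < a2 -> 0 < Ti -> 0 < kappa -> 0 < p -> 0 < T ->
  let alpha := ionization Ti kappa p T in
  let z := Ti / T in
  let alpha_p := - (alpha * (1 - alpha ^ 2) / (2 * p)) in
  is_derive (fun q => lambda_sq a2 Ti kappa q T) p
    (lambda_sq a2 Ti kappa p T
     * (2 / p - alpha_p / (1 + alpha)
        + 1 / 2 * (1 - 2 * alpha) * alpha_p * (5 / 2 + z) ^ 2
          / numerator alpha z
        - 1 / 2 * (1 - 2 * alpha) * alpha_p * (15 / 4 + 3 * z + z ^ 2)
          / denominator alpha z)).
Proof.
intros Ha2 HTi Hk Hp HT alpha z alpha_p.
assert (Hb := ionization_bounds Ti kappa p T Hk Hp); fold alpha in Hb.
assert (Hz : 0 < z) by now apply Rdiv_lt_0_compat.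
assert (HN := numerator_gt0 _ _ Hb Hz).
assert (HD := denominator_gt0 _ _ Hb Hz).
apply (is_derive_ext (fun q => q ^ 2 * numerator (ionization Ti kappa q T) z
  / (a2 * T * (1 + ionization Ti kappa q T)
     * denominator (ionization Ti kappa q T) z))).
{ intros q; symmetry; now apply lambda_sqE. }
rewrite lambda_sqE by assumption; fold alpha; fold z.
assert (Hd := is_derive_ionization_p Ti kappa p T Hk Hp HT).
cbv zeta in Hd; fold alpha alpha_p in Hd.
unfold numerator, denominator in *.
auto_derive; fold alpha.
{ repeat split; try (eexists; exact Hd).
  apply Rgt_not_eq; repeat apply Rmult_lt_0_compat; simpl in *; lra. }
rewrite (is_derive_unique _ _ _ Hd : Derive (fun q : R => _) _ = _).
clearbody alpha_p alpha z.
field; repeat split; lra.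
Qed.

Lemma is_derive_lambda_sq_T (a2 Ti kappa p T : R) :
  0 < a2 -> 0 < Ti -> 0 < kappa -> 0 < p -> 0 < T ->
  let alpha := ionization Ti kappa p T in
  let z := Ti / T in
  let alpha_T := alpha * (1 - alpha ^ 2) * (5 / 2 + z) / (2 * T) in
  let z_T := - (z / T) in
  let w := alpha * (1 - alpha) in
  let w_T := (1 - 2 * alpha) * alpha_T in
  is_derive (fun S => lambda_sq a2 Ti kappa p S) T
    (lambda_sq a2 Ti kappa p T
     * (- / T - alpha_T / (1 + alpha)
        + 1 / 2 * (w_T * (5 / 2 + z) ^ 2 + 2 * w * (5 / 2 + z) * z_T)
          / numerator alpha z
        - 1 / 2 * (w_T * (15 / 4 + 3 * z + z ^ 2) + w * (3 + 2 * z) * z_T)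
          / denominator alpha z)).
Proof.
intros Ha2 HTi Hk Hp HT alpha z alpha_T z_T w w_T.
assert (Hb := ionization_bounds Ti kappa p T Hk Hp); fold alpha in Hb.
assert (Hz : 0 < z) by now apply Rdiv_lt_0_compat.
assert (HN := numerator_gt0 _ _ Hb Hz).
assert (HD := denominator_gt0 _ _ Hb Hz).
apply (is_derive_ext_loc (fun S => p ^ 2 * numerator (ionization Ti kappa p S) (Ti / S)
  / (a2 * S * (1 + ionization Ti kappa p S)
     * denominator (ionization Ti kappa p S) (Ti / S)))).
{ apply (filter_imp (fun S => 0 < S)); [|now apply (open_gt 0)].
  intros S HS; symmetry; now apply lambda_sqE. }
rewrite lambda_sqE by assumption; fold alpha; fold z.
assert (Hd := is_derive_ionization_T Ti kappa p T Hk Hp HT).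
cbv zeta in Hd; fold alpha in Hd; fold z in Hd; fold alpha_T in Hd.
unfold numerator, denominator in *.
auto_derive; fold alpha; change (Ti * / T) with z.
{ repeat split; try (eexists; exact Hd); try lra.
  apply Rgt_not_eq; repeat apply Rmult_lt_0_compat; simpl in *; lra. }
rewrite (is_derive_unique _ _ _ Hd : Derive (fun S : R => _) _ = _).
assert (HTz : Ti = z * T) by (unfold z; field; lra).
unfold w_T, w, z_T; clearbody alpha_T alpha z; subst Ti.
field; repeat split; lra.
Qed.

(** The factor 4 N^2 * 2 D, with N and D the numerator and the denominator
    bracket, is the common denominator of the logarithmic derivatives. *)
Lemma R_plus_lambda_sq (a2 Ti kappa p T : R) :
  0 < a2 -> 0 < Ti -> 0 < kappa -> 0 < p -> 0 < T ->
  let alpha := ionization Ti kappa p T in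
  let z := Ti / T in
  R_plus Ti kappa (lambda_sq a2 Ti kappa) p T
  = lambda_sq a2 Ti kappa p T / p * nonlinearity_poly alpha z
    / ((2 * numerator alpha z) ^ 2 * (2 * denominator alpha z)).
Proof.
intros Ha2 HTi Hk Hp HT alpha z.
assert (Hb := ionization_bounds Ti kappa p T Hk Hp); fold alpha in Hb.
assert (Hz : 0 < z) by now apply Rdiv_lt_0_compat.
assert (HN := numerator_gt0 _ _ Hb Hz).
assert (HD := denominator_gt0 _ _ Hb Hz).
unfold R_plus.
assert (Ep : d_p (entropy Ti kappa) p T
             = - (1 + alpha) / (2 * p)
               * (2 + alpha * (1 - alpha) * (5 / 2 + z))).
{ unfold d_p.
  rewrite (is_derive_unique _ _ _ (is_derive_entropy_p Ti kappa p T Hk Hp HT)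
           : Derive (fun q : R => _) _ = _).
  fold alpha; fold z; clearbody alpha z; field; lra. }
assert (ET : d_T (entropy Ti kappa) p T = (1 + alpha) / T * numerator alpha z).
{ unfold d_T.
  rewrite (is_derive_unique _ _ _ (is_derive_entropy_T Ti kappa p T Hk Hp HT)
           : Derive (fun q : R => _) _ = _).
  fold alpha; fold z; unfold numerator.
  replace ((1 + alpha) * Ti / T ^ 2) with ((1 + alpha) * z / T)
    by (unfold z; field; lra).
  clearbody alpha z; field; lra. }
rewrite Ep, ET; unfold d_p, d_T.
rewrite (is_derive_unique _ _ _
  (is_derive_lambda_sq_p a2 Ti kappa p T Ha2 HTi Hk Hp HT)
  : Derive (fun q : R => _) _ = _).
rewrite (is_derive_unique _ _ _
  (is_derive_lambda_sq_T a2 Ti kappa p T Ha2 HTi Hk Hp HT)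
  : Derive (fun q : R => _) _ = _).
fold alpha; fold z.
set (L := lambda_sq a2 Ti kappa p T).
unfold nonlinearity_poly, numerator, denominator in *.
clearbody L alpha z; field; repeat split; lra.
Qed.

(** * Genuine nonlinearity *)

(** R_+ is a derivation, so this is the chain rule for the square root. *)
Lemma R_plus_lambda_plus (a2 Ti kappa p T : R) :
  0 < a2 -> 0 < Ti -> 0 < kappa -> 0 < p -> 0 < T ->
  R_plus Ti kappa (lambda_plus a2 Ti kappa) p T
  = R_plus Ti kappa (lambda_sq a2 Ti kappa) p T
    / (2 * lambda_plus a2 Ti kappa p T).
Proof.
intros Ha2 HTi Hk Hp HT.
assert (HL := lambda_sq_gt0 a2 Ti kappa p T Ha2 HTi Hk Hp HT).
assert (Hl : 0 < sqrt (lambda_sq a2 Ti kappa p T)) by now apply sqrt_lt_R0.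
assert (HeT := entropy_T_gt0 Ti kappa p T HTi Hk Hp HT).
assert (Dp := is_derive_lambda_sq_p a2 Ti kappa p T Ha2 HTi Hk Hp HT).
assert (DT := is_derive_lambda_sq_T a2 Ti kappa p T Ha2 HTi Hk Hp HT).
cbv zeta in Dp, DT.
assert (Ep : d_p (lambda_plus a2 Ti kappa) p T
  = d_p (lambda_sq a2 Ti kappa) p T / (2 * sqrt (lambda_sq a2 Ti kappa p T))).
{ unfold d_p, lambda_plus.
  rewrite (is_derive_unique _ _ _ Dp : Derive (fun q : R => _) _ = _).
  apply is_derive_unique.
  exact (is_derive_sqrt _ _ _ Dp HL). }
assert (ET : d_T (lambda_plus a2 Ti kappa) p T
  = d_T (lambda_sq a2 Ti kappa) p T / (2 * sqrt (lambda_sq a2 Ti kappa p T))).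
{ unfold d_T, lambda_plus.
  rewrite (is_derive_unique _ _ _ DT : Derive (fun q : R => _) _ = _).
  apply is_derive_unique.
  exact (is_derive_sqrt _ _ _ DT HL). }
unfold R_plus; rewrite Ep, ET; unfold lambda_plus.
field; lra.
Qed.

Lemma R_minus_lambda_minus (a2 Ti kappa p T : R) :
  R_minus Ti kappa (lambda_minus a2 Ti kappa) p T
  = R_plus Ti kappa (lambda_plus a2 Ti kappa) p T.
Proof.
unfold R_minus, R_plus.
assert (Ep : d_p (lambda_minus a2 Ti kappa) p T
             = - d_p (lambda_plus a2 Ti kappa) p T) by apply Derive_opp.
assert (ET : d_T (lambda_minus a2 Ti kappa) p T
             = - d_T (lambda_plus a2 Ti kappa) p T) by apply Derive_opp.
rewrite Ep, ET; ring.
Qed.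

Lemma pressure_gt0 (Ti kappa alpha T : R) :
  0 < kappa -> 0 < alpha < 1 -> 0 < pressure Ti kappa alpha T.
Proof.
intros Hk Ha; unfold pressure.
repeat apply Rmult_lt_0_compat; try apply exp_pos.
- now apply Rinv_0_lt_compat.
- nra.
- apply Rinv_0_lt_compat, pow_lt; lra.
Qed.

Theorem theorem4p1 :
  forall a2 Ti kappa : R, 0 < a2 -> 0 < Ti -> 0 < kappa ->
  forall alpha T : R, 0 < alpha < 1 -> 0 < T ->
  (alpha <= 60 * (T / Ti) ^ 3 \/ Ti / T <= 545375 / 10000) ->
  let p := pressure Ti kappa alpha T in
  genuinely_nonlinear_plus a2 Ti kappa p T /\
  genuinely_nonlinear_minus a2 Ti kappa p T.
Proof.
intros a2 Ti kappa Ha2 HTi Hk alpha T Ha HT Hcond p.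
assert (Hp : 0 < p) by now apply pressure_gt0.
assert (Hz : 0 < Ti / T) by now apply Rdiv_lt_0_compat.
assert (HP : 0 < nonlinearity_poly alpha (Ti / T)).
{ destruct Hcond as [Hsmall|Hhigh].
  - apply nonlinearity_poly_gt0_small_ionization; [assumption..|].
    replace 60 with (60 * (T / Ti) ^ 3 * (Ti / T) ^ 3) by (field; lra).
    apply Rmult_le_compat_r; [apply pow_le|]; lra.
  - now apply nonlinearity_poly_gt0_high_temperature. }
unfold genuinely_nonlinear_minus; rewrite R_minus_lambda_minus.
enough (0 < R_plus Ti kappa (lambda_plus a2 Ti kappa) p T) by now split.
rewrite R_plus_lambda_plus, R_plus_lambda_sq by assumption.
assert (Halpha : ionization Ti kappa p T = alpha)
  by now apply ionization_pressure.
rewrite Halpha.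
assert (HL := lambda_sq_gt0 a2 Ti kappa p T Ha2 HTi Hk Hp HT).
assert (HN := numerator_gt0 _ _ Ha Hz).
assert (HD := denominator_gt0 _ _ Ha Hz).
assert (Hl : 0 < lambda_plus a2 Ti kappa p T) by now apply sqrt_lt_R0.
apply Rdiv_lt_0_compat; [|lra].
apply Rdiv_lt_0_compat; apply Rmult_lt_0_compat; try assumption; try lra.
- now apply Rdiv_lt_0_compat.
- apply pow_lt; lra.
Qed.
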